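(* There is a sufficiently large absolute constant $C_0$ such that the following holds. Let $0<\varepsilon<1/2$, let $m$ be the number of vertices, and assume $W\ge m^{C_0}$. Then any randomized turnstile streaming algorithm that, on every unit update strict turnstile stream of length at most $W$ whose final frequency vector encodes a multigraph $G$ on $m$ vertices, outputs with success probability at least $2/3$ a matching $M$ in $G$ with $|M|\ge\mathsf{OPT}(G)/m^{\varepsilon}$ must use $\Omega(m^{2-3\varepsilon-o(1)})$ bits of space.
   Context: The frequency vector lives in $\mathbb Z^{\binom m2}$, one coordinate per unordered pair of the vertex set $[m]$; a nonnegative vector encodes the multigraph with those edge multiplicities. $\mathsf{OPT}(G)$ is the maximum matching size of $G$. A unit update turnstile stream is a sequence of updates $\pm1$ on single coordinates starting from $0$; it is strict if every prefix frequency vector has all coordinates nonnegative. A randomized streaming algorithm using $S$ bits is a public-coin family of deterministic streaming algorithms each with at most $2^S$ memory states; the seed is not counted toward the space and success probability is over the seed for each fixed stream. *)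

(* Defs.v *)
From HB Require Import structures.
From mathcomp Require Import all_boot all_order all_algebra.
From mathcomp Require Import all_classical all_reals all_analysis.

Set Implicit Arguments.
Unset Strict Implicit.
Unset Printing Implicit Defensive.

Import Order.TTheory GRing.Theory Num.Theory.
Import numFieldNormedType.Exports.

Local Open Scope classical_set_scope.
Local Open Scope ring_scope.

Definition edge (m : nat) : finType := {e : {set 'I_m} | #|e| == 2%N}.

Definition freq_vector (m : nat) : Type := {ffun edge m -> int}.

Definition multigraph (m : nat) : Type := {ffun edge m -> nat}.

Definition encodes (m : nat) (f : freq_vector m) (G : multigraph m) : Prop :=
  forall e, f e = (G e)%:Z.

Definition is_matching (m : nat) (G : multigraph m) (M : {set edge m}) : bool :=
  [forall e in M, (0 < G e)%N] &&
  [forall e in M, forall e' in M,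
     (e != e') ==> [disjoint (val e : {set 'I_m}) & (val e' : {set 'I_m})]].

Definition OPT (m : nat) (G : multigraph m) : nat :=
  (\max_(M : {set edge m} | is_matching G M) #|M|)%N.

(* [(e, true)] adds 1 to the coordinate [e]; [(e, false)] subtracts 1. *)
Definition update (m : nat) : Type := (edge m * bool)%type.

Definition stream (m : nat) : Type := seq (update m).

Definition freq (m : nat) (s : stream m) : freq_vector m :=
  [ffun e => \sum_(u <- s | u.1 == e) (if u.2 then 1 else -1)].

Definition strict (m : nat) (s : stream m) : Prop :=
  forall (k : nat) (e : edge m), 0 <= freq (take k s) e.

Record det_alg (m S : nat) : Type := DetAlg {
  state : finType;
  state_card : (#|state| <= 2 ^ S)%N;
  init : state;
  step : state -> update m -> state;
  output : state -> {set edge m}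
}.

Definition run (m S : nat) (A : det_alg m S) (s : stream m) : {set edge m} :=
  output (foldl (@step m S A) (init A) s).

(* The seed space is an arbitrary probability space; [alg_meas] says that the
   output on each fixed stream is a random variable (with finitely many values),
   so that success events have a probability. *)
Record rand_alg (R : realType) (m S : nat) : Type := RandAlg {
  seed_disp : measure_display;
  seed : measurableType seed_disp;
  seed_law : probability seed R;
  alg : seed -> det_alg m S;
  alg_meas : forall (s : stream m) (M : {set edge m}),
    measurable [set w | run (alg w) s = M]
}.

Definition approx_matching (R : realType) (eps : R) (m : nat)
    (G : multigraph m) (M : {set edge m}) : Prop :=
  is_matching G M /\ (OPT G)%:R / m%:R `^ eps <= (#|M|)%:R :> R.

Definition solves_matching (R : realType) (eps : R) (m S W : nat)
    (A : rand_alg R m S) : Prop :=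
  forall (s : stream m) (G : multigraph m),
    strict s -> (size s <= W)%N -> encodes (freq s) G ->
    ((2 / 3)%:E <=
       seed_law A [set w | approx_matching eps G (run (alg w) s)])%E.

(* Main.v *)
Require Import Defs.
From HB Require Import structures.
From mathcomp Require Import all_boot all_order all_algebra all_fingroup.
From mathcomp Require Import all_classical all_reals all_analysis.
From mathcomp Require Import measurable_realfun.
From mathcomp Require Import ring lra zify.

Set Implicit Arguments.
Unset Strict Implicit.
Unset Printing Implicit Defensive.

Import Order.TTheory GRing.Theory Num.Theory.
Import numFieldNormedType.Exports.

Local Open Scope ring_scope.

(** Write [G] for the final graph and let [Y] be uniform in [Z_q^E]. The stream
    inserts [Y + G] and then deletes [Y]; the state between the two phases is a
    function of [Y + G] alone, and, up to rare wrap-around modulo [q], adding a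
    part of [G] to [Y] does not change the law of [Y]. So the state treats each
    part of [G] as if the others were absent, as a linear sketch would.

    [G] is a union of [k] copies of a Ruzsa-Szemeredi graph built from a
    Behrend-type set without three-term progressions. In the copy of player [i]
    the vertices of one induced matching, of secret index [z i], are private and
    all other vertices are shared by the players; the bits of the copy choose
    the right endpoints of its edges. The private matchings give
    [OPT >= k * #|A|], while only [3 * #|Gam|] edges of a matching can touch
    shared vertices, so a good output guesses many bits of private matchings.
    Under a random relabelling the state carries no information on [z i], hence
    its [S] bits are spread evenly over the [#|Gam|] induced matchings of each
    copy. *)

(** * Scoring claims about uniform bits *)

(** A fair bet: the factors average to 1, yet a success rate of 3/5 gives a positive mean
    logarithm. *)
Definition weight (R : realType) (c : option bool) (b : bool) : R :=
  if c is Some c' then (if c' == b then 6 / 5 else 4 / 5) else 1.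

Definition score (R : realType) (c : option bool) (b : bool) : R :=
  ln (weight R c b).

Lemma weight_gt0 (R : realType) (c : option bool) (b : bool) :
  0 < weight R c b.
Proof. by case: c => [c|] /=; [case: ifP => _; lra|exact: ltr01]. Qed.

Lemma sum_weight (R : realType) (c : option bool) :
  \sum_b weight R c b = 2.
Proof. by rewrite big_bool /=; case: c => [[]|] /=; lra. Qed.

Lemma ln_prod (R : realType) (I : Type) (s : seq I) (F : I -> R) :
  (forall i, 0 < F i) -> ln (\prod_(i <- s) F i) = \sum_(i <- s) ln (F i).
Proof.
move=> F0; elim: s => [|i s IHs]; first by rewrite !big_nil ln1.
by rewrite !big_cons lnM ?IHs // posrE // prodr_gt0.
Qed.

(* For fixed claims the product of the weights has mean 1 over uniform bits, so
   the sum of these products over all states has mean at most [2 ^ S];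
   [ln y <= y - 1] then bounds the mean of the logarithm. *)
Lemma sum_score_le (R : realType) (S : nat) (U St : finType)
    (f : {ffun U -> bool} -> St) (C : St -> U -> option bool) :
  (#|St| <= 2 ^ S)%N ->
  \sum_(b : {ffun U -> bool}) \sum_u score R (C (f b) u) (b u) <=
  #|{ffun U -> bool}|%:R * (S%:R * ln 2).
Proof.
move=> leS.
pose W s (b : {ffun U -> bool}) : R := \prod_u weight R (C s u) (b u).
have W0 s b : 0 < W s b by apply: prodr_gt0 => u _; exact: weight_gt0.
have sumW s : \sum_b W s b = #|{ffun U -> bool}|%:R.
  transitivity (\prod_u \sum_b weight R (C s u) b).
    by rewrite bigA_distr_bigA.
  under eq_bigr do rewrite sum_weight.
  by rewrite prodr_const card_ffun card_bool natrX.
have P2 : 0 < 2 ^+ S :> R by apply: exprn_gt0; lra.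
have le1 b : \sum_u score R (C (f b) u) (b u) <=
    S%:R * ln 2 + (W (f b) b / 2 ^+ S - 1).
  rewrite /score -ln_prod => [|u]; last exact: weight_gt0.
  rewrite -/(W (f b) b) -[in leLHS](mulfVK (lt0r_neq0 P2) (W (f b) b)).
  rewrite lnM ?posrE ?divr_gt0 // lnXn; last by lra.
  rewrite addrC mulr_natl lerD2l.
  have := @le_ln1Dx R (W (f b) b / 2 ^+ S - 1).
  rewrite (addrC 1) subrK; apply.
  by rewrite ltrBrDl subrr divr_gt0.
apply: le_trans (ler_sum _ (fun b _ => le1 b)) _.
have cst (x : R) :
    \sum_(b : {ffun U -> bool}) x = #|{ffun U -> bool}|%:R * x.
  by rewrite sumr_const mulr_natl.
rewrite big_split /= cst gerDl sumrB -mulr_suml cst mulr1.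
rewrite subr_le0 ler_pdivrMr //.
apply: (@le_trans _ _ (\sum_s \sum_b W s b)).
  rewrite exchange_big /=; apply: ler_sum => b _.
  by rewrite (bigD1 (f b)) //= lerDl sumr_ge0 // => s _; exact: ltW.
under eq_bigr do rewrite sumW.
rewrite sumr_const -[leLHS]mulr_natr ler_wpM2l ?ler0n //.
by rewrite -natrX ler_nat.
Qed.

Definition fset_at (I T : finType) (z : {ffun I -> T}) (i : I) (x : T) :
    {ffun I -> T} :=
  [ffun j => if j == i then x else z j].

Lemma fset_atE (I T : finType) (z : {ffun I -> T}) (i : I) (x : T) :
  fset_at z i x i = x.
Proof. by rewrite ffunE eqxx. Qed.

(** Exchanging [z i] with the fresh [x] is an involution on pairs, so resampling a coordinate keeps
    the law uniform. *)
Lemma sum_fset_at (R : pzRingType) (I T : finType) (i : I)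
    (F : {ffun I -> T} -> R) :
  \sum_z \sum_x F (fset_at z i x) = #|T|%:R * \sum_z F z.
Proof.
pose g (p : {ffun I -> T} * T) := (fset_at p.1 i p.2, p.1 i).
have gK : involutive g.
  case=> z x; rewrite /g /= ffunE eqxx; congr pair.
  by apply/ffunP => j; rewrite !ffunE; case: eqP => [->|].
rewrite pair_bigA /= (reindex_inj (inv_inj gK)) /=.
transitivity (\sum_(p : {ffun I -> T} * T) F p.1).
  by apply: eq_bigr => p _; have /(congr1 fst) /= -> := gK p.
rewrite -(pair_bigA _ (fun z _ => F z)) /=.
under eq_bigr do rewrite sumr_const.
by rewrite sumrMnl mulr_natl.
Qed.

(** * Insertion and deletion streams *)

Section Streams.

Variable m : nat.

Definition updates (sgn : bool) (X : edge m -> nat) : stream m :=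
  flatten [seq nseq (X e) (e, sgn) | e <- enum (edge m)].

Lemma freq_cat (s t : stream m) (e : edge m) :
  freq (s ++ t) e = freq s e + freq t e.
Proof. by rewrite !ffunE big_cat. Qed.

Lemma freq_updates (sgn : bool) (X : edge m -> nat) (e : edge m) :
  freq (updates sgn X) e = if sgn then (X e)%:Z else - (X e)%:Z.
Proof.
rewrite ffunE big_flatten big_map big_enum /=.
rewrite (bigD1 e) //= big_nseq_cond /= eqxx iter_addr_0 big1 ?addr0 //.
  by case: sgn; rewrite ?mulNrn natz.
by move=> e' ne; rewrite big_nseq_cond /= (negbTE ne).
Qed.

Lemma all_updates (sgn : bool) (X : edge m -> nat) :
  all (fun u => u.2 == sgn) (updates sgn X).
Proof.
rewrite /updates; elim: (enum _) => //= e s IHs.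
by rewrite all_cat IHs andbT all_nseq eqxx orbT.
Qed.

Lemma freq_insertions_ge0 (s : stream m) (e : edge m) :
  all (fun u => u.2 == true) s -> 0 <= freq s e.
Proof.
rewrite ffunE; elim: s => [|[e' c] s IHs] /=; first by rewrite big_nil.
move=> /andP[/eqP -> /IHs s0]; rewrite big_cons /=; case: ifP => // _.
exact: addr_ge0.
Qed.

Lemma freq_deletions_le0 (s : stream m) (e : edge m) :
  all (fun u => u.2 == false) s -> freq s e <= 0.
Proof.
rewrite ffunE; elim: s => [|[e' c] s IHs] /=; first by rewrite big_nil.
move=> /andP[/eqP -> /IHs s0]; rewrite big_cons /=; case: ifP => // _.
by rewrite -[leRHS]addr0 lerD.
Qed.

(** During the deletions the frequency is [X e - Y e] plus what is still to be deleted. *)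
Lemma strict_updates (X Y : edge m -> nat) :
  (forall e, Y e <= X e)%N -> strict (updates true X ++ updates false Y).
Proof.
move=> YX n e; rewrite take_cat; case: ifP => _.
  apply: freq_insertions_ge0; have := all_updates true X.
  by rewrite -{1}(cat_take_drop n (updates true X)) all_cat => /andP[].
set n' := (n - _)%N.
have d0 : freq (drop n' (updates false Y)) e <= 0.
  apply: freq_deletions_le0; have := all_updates false Y.
  by rewrite -{1}(cat_take_drop n' (updates false Y)) all_cat => /andP[].
have := freq_updates false Y e.
rewrite -{1}(cat_take_drop n' (updates false Y)).
rewrite !freq_cat freq_updates /= => H; have := YX e.
move: H d0; move: (freq _ e) (freq _ e) => x y; lia.
Qed.

Lemma size_updates (sgn : bool) (X : edge m -> nat) (B : nat) :
  (forall e, X e <= B)%N -> (size (updates sgn X) <= #|edge m| * B)%N.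
Proof.
move=> XB; rewrite size_flatten /shape -map_comp sumnE big_map big_enum /=.
rewrite -sum_nat_const; apply: leq_sum => e _.
by rewrite size_nseq.
Qed.

Lemma card_edge_le : (#|edge m| <= m ^ 2)%N.
Proof.
rewrite card_sig -cardsE card_draws card_ord bin2.
rewrite (leq_trans (half_leq (leqnn _))) // -divn2.
by rewrite (leq_trans (leq_div _ _)) //; nia.
Qed.

End Streams.

(** * Fixing the seed by averaging *)

Lemma exists_seed (R : realType) (d : measure_display) (T : measurableType d)
    (P : probability T R) (Om : finType) (N : {set Om}) (E : Om -> set T) :
  (forall o, measurable (E o)) ->
  (forall o, o \in N -> ((2 / 3)%:E <= P (E o))%E) ->
  exists w, (2 * #|N| <= 3 * #|[set o in N | w \in E o]%SET|)%N.
Proof.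
move=> mE PE; apply: contrapT => nex.
have lt w : (3 * #|[set o in N | w \in E o]%SET| < 2 * #|N|)%N.
  by rewrite ltnNge; apply/negP => le; apply: nex; exists w.
(* Subtracting 1 turns the strict integer inequality into a uniform gap, so strictness survives
   integration. *)
pose c : R := (2 * #|N|%:R - 1) / 3.
have : (\int[P]_(w in setT) (\sum_(o <- enum N) (\1_(E o) w)%:E) <=
    \int[P]_(w in setT) (cst c%:E) w)%E.
  apply: ge0_le_integral => //.
  - by move=> w _; apply: sume_ge0 => o _; rewrite lee_fin.
  - apply: emeasurable_sum => o; apply/measurable_EFinP.
    exact: measurable_indic.
  move=> w _; rewrite sumEFin lee_fin big_enum /=.
  have -> : \sum_(o in N) \1_(E o) w = #|[set o in N | w \in E o]%SET|%:R :> R.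
    rewrite -sum1_card natr_sum [RHS]big_mkcond [LHS]big_mkcond /=.
    by apply: eq_bigr => o _; rewrite inE indicE; case: ifP => //= _; case: ifP.
  have := lt w; rewrite -(ler_nat R) -natr1 !natrM /c; lra.
rewrite integral_cst // [X in (_ * X)%E](probability_setT P) mule1.
rewrite ge0_integral_sum //; last first.
  by move=> o; apply/measurable_EFinP; exact: measurable_indic.
rewrite (eq_bigr (fun o => P (E o))) => [|o _]; last first.
  by rewrite integral_indic // setIT.
rewrite leNgt => /negP; apply.
apply: (@lt_le_trans _ _ (\sum_(o <- enum N) (2 / 3)%:E)%E).
  rewrite sumEFin lte_fin big_enum sumr_const /= -mulr_natl /c; lra.
rewrite big_seq_cond [leRHS]big_seq_cond; apply: lee_sum => o.
by rewrite mem_enum andbT => /PE.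
Qed.

(** * Construction of the hard instance *)

Section HardInstance.

Variables (m k Q : nat) (Gam : finZmodType) (A : {set Gam}).

Definition vertex : finType := (option 'I_k * (Gam * option bool))%type.

Variable h : vertex -> 'I_m.

Definition seeds : finType := {ffun 'I_k -> Gam}.

Definition player_bits : finType := {ffun Gam * Gam -> bool}.

Definition bits : finType := {ffun 'I_k -> player_bits}.

Local Notation noise := {ffun edge m -> 'I_Q.+1}.

(** The endpoints of the [z]-th induced matching: its edges join [z + a] to a copy of [z + a + a],
    for [a] in [A]. *)
Definition private (z : Gam) (v : Gam * option bool) : bool :=
  if v.2 is Some _ then [exists a in A, v.1 == z + a + a] else v.1 - z \in A.

(** Rows are exchanged, not overwritten, so that the relabelling is a permutation, which the uniform
    [rho] absorbs. *)
Definition swap (i : 'I_k) (z : Gam) (w : vertex) : vertex :=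
  if private z w.2 then
    match w.1 with
    | None => (Some i, w.2)
    | Some j => if j == i then (None, w.2) else w
    end
  else w.

Lemma swapK (i : 'I_k) (z : Gam) : involutive (swap i z).
Proof.
rewrite /swap => -[[j|] v] /=; have [pv|/negbTE pv] := boolP (private z v);
  rewrite /= ?pv //= ?eqxx //.
by case: eqP => [->|/eqP/negbTE ji] /=; rewrite pv /= ?ji.
Qed.

Definition swap_perm (i : 'I_k) (z : Gam) : {perm vertex} :=
  perm (inv_inj (swapK i z)).

Lemma swap_permK (i : 'I_k) (z : Gam) : (swap_perm i z * swap_perm i z = 1)%g.
Proof. by apply/permP => w; rewrite permM perm1 !permE swapK. Qed.

Definition left_end (p : Gam * Gam) : Gam * option bool := (p.1 + p.2, None).

Definition right_end (p : Gam * Gam) (b : bool) : Gam * option bool :=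
  (p.1 + p.2 + p.2, Some b).

Definition joins (rho : {perm vertex}) (u w : vertex) (e : edge m) : bool :=
  val e == [set h (rho u); h (rho w)]%SET.

(* [(p.1, p.2)] indexes the edge [p.2] of the [p.1]-th induced matching of the
   Ruzsa-Szemeredi graph; the bit selects one of the two copies of its right
   endpoint. *)
Definition base_mult (rho : {perm vertex}) (b : player_bits) (e : edge m) :
    nat :=
  #|[set p : Gam * Gam | (p.2 \in A) &&
      joins rho (None, left_end p) (None, right_end p (b p)) e]%SET|.

(* Player [i] holds the base graph with the vertices of its [z i]-th induced
   matching moved to the private row [Some i]. *)
Definition hard_graph (rho : {perm vertex}) (z : seeds) (b : bits) :
    multigraph m :=
  [ffun e => (\sum_i base_mult (swap_perm i (z i) * rho)%g (b i) e)%N].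

Definition base_vec (rho : {perm vertex}) (b : player_bits) : noise :=
  [ffun e => inZp (base_mult rho b e)].

Definition hard_vec (rho : {perm vertex}) (z : seeds) (b : bits) : noise :=
  \sum_i base_vec (swap_perm i (z i) * rho)%g (b i).

Lemma hard_vecE (rho : {perm vertex}) (z : seeds) (b : bits) (e : edge m) :
  hard_vec rho z b e = inZp (hard_graph rho z b e).
Proof.
rewrite /hard_vec /hard_graph sum_ffunE ffunE.
elim/big_rec2: _ => [|i x y _ ->]; first exact/val_inj.
rewrite [base_vec _ _ _]ffunE.
by apply/val_inj; rewrite /= modnDm.
Qed.

(* The permutation [swap_perm i j] is absorbed by the uniform [rho], so the
   state carries no information on the seed [z i] of player [i]: the [#|Gam|]
   possible seeds share the same [S] bits. *)
Lemma sum_player_score_le (R : realType) (S : nat) (St : finType)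
    (f : noise -> St)
    (cl : St -> noise -> {perm vertex} -> seeds -> 'I_k -> Gam -> option bool)
    (i : 'I_k) :
  (#|St| <= 2 ^ S)%N ->
  #|Gam|%:R * (\sum_z \sum_b \sum_rho \sum_(Y : noise) \sum_a
    score R (cl (f (Y + hard_vec rho z b)) Y rho z i a) (b i (z i, a))) <=
  (#|seeds| * #|bits| * #|{perm vertex}| * #|noise|)%:R * (S%:R * ln 2) :> R.
Proof.
move=> leS.
pose T (z : seeds) (b : bits) (rho : {perm vertex}) (Y : noise) : R := \sum_a
    score R (cl (f (Y + hard_vec rho z b)) Y rho z i a) (b i (z i, a)).
rewrite -(@ler_pM2l _ #|player_bits|%:R); last first.
  by rewrite ltr0n; apply/card_gt0P; exists [ffun=> true].
have -> : #|player_bits|%:R * (#|Gam|%:R *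
      (\sum_z \sum_b \sum_rho \sum_(Y : noise) T z b rho Y)) =
    \sum_z \sum_b \sum_j \sum_c \sum_rho \sum_(Y : noise)
      T (fset_at z i j) (fset_at b i c) rho Y.
  transitivity (\sum_z \sum_j \sum_b \sum_c \sum_rho \sum_(Y : noise)
      T (fset_at z i j) (fset_at b i c) rho Y).
    rewrite mulrCA mulr_sumr -(sum_fset_at i).
    apply: eq_bigr => z _; apply: eq_bigr => j _.
    by rewrite -(sum_fset_at i).
  by apply: eq_bigr => z _; exact: exchange_big.
have cst (J : finType) (x : R) : \sum_(j : J) x = #|J|%:R * x.
  by rewrite sumr_const mulr_natl.
have le1 z b : \sum_j \sum_c \sum_rho \sum_(Y : noise)
      T (fset_at z i j) (fset_at b i c) rho Y <=
    \sum_(rho : {perm vertex}) \sum_(Y : noise)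
      #|player_bits|%:R * (S%:R * ln 2).
  (* The part of the other players once [rho] becomes [swap_perm i j * rho]. Subtracting it from [Y]
     leaves the state to see [Y + base_vec rho c], free of [j]. *)
  pose other (rho : {perm vertex}) j : noise :=
    \sum_(i' | i' != i) base_vec (swap_perm i' (z i') * (swap_perm i j * rho))%g
      (b i').
  have -> : \sum_j \sum_c \sum_rho \sum_(Y : noise)
      T (fset_at z i j) (fset_at b i c) rho Y =
    \sum_j \sum_c \sum_rho \sum_(Y : noise)
      T (fset_at z i j) (fset_at b i c) (swap_perm i j * rho)%g
        (Y - other rho j).
    apply: eq_bigr => j _; apply: eq_bigr => c _.
    rewrite (reindex_inj (mulgI (swap_perm i j))) /=.
    apply: eq_bigr => rho _.
    by rewrite (reindex_inj (addIr (- other rho j))).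
  under eq_bigr do rewrite exchange_big /=.
  rewrite exchange_big /=; apply: ler_sum => rho _.
  under eq_bigr do rewrite exchange_big /=.
  rewrite exchange_big /=; apply: ler_sum => Y _.
  rewrite exchange_big /=.
  (* One state thus serves every seed [j]: the claims under all seeds form one family about the bits
     [c]. *)
  pose C s (p : Gam * Gam) := cl s (Y - other rho p.1)
    (swap_perm i p.1 * rho)%g (fset_at z i p.1) i p.2.
  apply: le_trans
    (@sum_score_le R S _ _ (fun c => f (Y + base_vec rho c)) C leS).
  apply: ler_sum => c _; rewrite /T pair_bigA /=; apply: ler_sum => -[j a] _ /=.
  rewrite !fset_atE.
  suff -> : Y - other rho j + hard_vec (swap_perm i j * rho)%g (fset_at z i j)
      (fset_at b i c) = Y + base_vec rho c by [].
  rewrite /hard_vec (bigD1 i) //= !fset_atE mulgA swap_permK mul1g.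
  rewrite (eq_bigr (fun i' => base_vec (swap_perm i' (z i') *
    (swap_perm i j * rho))%g (b i'))) => [|i' ni].
    by rewrite -/(other rho j) -addrA [_ + other _ _]addrC addKr.
  by rewrite !ffunE (negbTE ni).
apply: le_trans (ler_sum _ (fun z _ => ler_sum _ (fun b _ => le1 z b))) _.
rewrite !cst !natrM; lra.
Qed.

(** * Edges of the hard graph *)

Hypothesis hI : injective h.

Lemma swap_public (i : 'I_k) (z : Gam) (v : Gam * option bool) :
  swap i z (None, v) = (if private z v then Some i else None, v).
Proof. by rewrite /swap /=; case: ifP. Qed.

Lemma joins_swap (rho : {perm vertex}) (i : 'I_k) (z : Gam) (u w : vertex)
    (e : edge m) :
  joins (swap_perm i z * rho)%g u w e = joins rho (swap i z u) (swap i z w) e.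
Proof. by rewrite /joins !permM !permE. Qed.

Lemma mem_joins (rho : {perm vertex}) (u w x : vertex) (e : edge m) :
  joins rho u w e -> (h (rho x) \in val e) = (x == u) || (x == w).
Proof.
by move=> /eqP ->; rewrite !inE !(inj_eq hI) !(inj_eq perm_inj).
Qed.

(** Left endpoints carry [None] and right ones [Some], so an unordered pair still tells its ends
    apart. *)
Lemma joins_inj (rho : {perm vertex}) (u w u' w' : vertex) (e : edge m) :
  u.2.2 = None -> u'.2.2 = None -> w.2.2 != None -> w'.2.2 != None ->
  joins rho u w e -> joins rho u' w' e -> u = u' /\ w = w'.
Proof.
move=> uN u'N wS w'S J J'.
have := mem_joins u J; rewrite (mem_joins _ J') eqxx /= => uE.
have := mem_joins w J; rewrite (mem_joins _ J') eqxx orbT => wE.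
split.
  by move: uE => /orP[/eqP //|/eqP uw]; move: w'S; rewrite -uw uN.
by move: wE => /orP[/eqP wu|/eqP //]; move: wS; rewrite wu u'N.
Qed.

Lemma joins_exists (rho : {perm vertex}) (u w : vertex) :
  u != w -> exists e, joins rho u w e.
Proof.
move=> uw; have c2 : #|[set h (rho u); h (rho w)]%SET| == 2%N.
  by rewrite cards2 (inj_eq hI) (inj_eq perm_inj) uw.
by exists (exist (fun e : {set 'I_m} => #|e| == 2%N) _ c2); rewrite /joins /=.
Qed.

Lemma hard_graph_gt0P (rho : {perm vertex}) (z : seeds) (b : bits)
    (e : edge m) :
  reflect (exists i p, p.2 \in A /\ joins rho (swap i (z i) (None, left_end p))
      (swap i (z i) (None, right_end p (b i p))) e)
    (0 < hard_graph rho z b e)%N.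
Proof.
rewrite ffunE lt0n sum_nat_eq0 negb_forall; apply: (iffP existsP).
  move=> [i]; rewrite /= -lt0n => /card_gt0P[p].
  by rewrite inE joins_swap => /andP[pA pJ]; exists i, p.
move=> [i [p [pA pJ]]]; exists i; rewrite /= -lt0n; apply/card_gt0P; exists p.
by rewrite inE joins_swap pA pJ.
Qed.

(** The candidate edge for bit value [c]; for [a] in [A] exactly one candidate is in the graph. *)
Definition special (rho : {perm vertex}) (z : seeds) (i : 'I_k) (a : Gam)
    (c : bool) (e : edge m) : bool :=
  joins rho (Some i, left_end (z i, a)) (Some i, right_end (z i, a) c) e.

Lemma special_exists (rho : {perm vertex}) (z : seeds) (i : 'I_k) (a : Gam)
    (c : bool) :
  exists e, special rho z i a c e.
Proof. by apply: joins_exists; apply/eqP => -[]. Qed.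

Lemma private_left (z a : Gam) : a \in A -> private z (left_end (z, a)).
Proof. by move=> aA; rewrite /private /= addrC addKr. Qed.

Lemma private_right (z a : Gam) (c : bool) :
  a \in A -> private z (right_end (z, a) c).
Proof.
by move=> aA; rewrite /private /=; apply/existsP; exists a; rewrite aA /=.
Qed.

Lemma special_gt0 (rho : {perm vertex}) (z : seeds) (b : bits) (i : 'I_k)
    (a : Gam) (e : edge m) :
  a \in A -> special rho z i a (b i (z i, a)) e ->
  (0 < hard_graph rho z b e)%N.
Proof.
move=> aA sp; apply/hard_graph_gt0P; exists i, (z i, a); split=> //.
by rewrite !swap_public private_left ?private_right.
Qed.

(** The row gives the player, and cancellation recovers [p = z i] and [q = a] from [p + q] and
    [p + q + q]. *)
Lemma special_bit (rho : {perm vertex}) (z : seeds) (b : bits) (i : 'I_k)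
    (a : Gam) (c : bool) (e : edge m) :
  special rho z i a c e -> (0 < hard_graph rho z b e)%N -> c = b i (z i, a).
Proof.
move=> sp /hard_graph_gt0P[j [[p q] [_]]]; rewrite !swap_public => J.
have [//|//|//|//|] := joins_inj _ _ _ _ sp J.
case: ifP => // _ [<- /= pq] [_ /= pqq ->].
have qa : q = a by apply: (@addrI _ (z i + a)); rewrite [RHS]pqq pq.
by rewrite qa in pq *; rewrite (addIr a pq).
Qed.

(** * Induced matchings from the absence of progressions *)

Hypothesis apA : {in A & &, forall a b c : Gam, a + c = b + b -> a = b}.

Lemma double_inj : {in A &, forall a b : Gam, a + a = b + b -> a = b}.
Proof. by move=> a b aA bA; exact: apA. Qed.

(** If both ends of the edge [(p, q)] are private, then [p + q - z i], [a'], [q] is a progression in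
    [A], hence constant, and [p = z i]: the matchings are induced. *)
Lemma hard_graph_private (rho : {perm vertex}) (z : seeds) (b : bits)
    (e : edge m) :
  (0 < hard_graph rho z b e)%N ->
  (forall v, h (rho (None, v)) \notin val e) ->
  exists i a, special rho z i a (b i (z i, a)) e.
Proof.
move=> /hard_graph_gt0P[i [[p q] [/= qA]]]; rewrite !swap_public => J priv_e.
have pl : private (z i) (left_end (p, q)).
  apply: contraT => /negbTE np; have := priv_e (left_end (p, q)).
  by rewrite (mem_joins _ J) np eqxx.
have pr : private (z i) (right_end (p, q) (b i (p, q))).
  apply: contraT => /negbTE np.
  have := priv_e (right_end (p, q) (b i (p, q))).
  by rewrite (mem_joins _ J) np eqxx orbT.
rewrite pl pr in J; move: pl pr; rewrite /private /= => pl.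
move=> /existsP[a' /andP[a'A]].
move=> /eqP E.
have qE : p + q - z i + q = a' + a'.
  by rewrite addrAC E -[_ + a' + a']addrA [z i + _]addrC addrK.
have a'q : p + q - z i = a' := apA pl a'A qA qE.
have {}a'q : a' = q by move: qE; rewrite a'q => /addrI.
exists i, q; rewrite /special.
suff -> : z i = p by [].
have : p + q - z i = q by rewrite -[in RHS]a'q; exact: (apA pl a'A qA qE).
by move=> /eqP; rewrite subr_eq addrC eq_sym => /eqP /addrI.
Qed.

Definition special_edge (rho : {perm vertex}) (z : seeds) (b : bits)
    (ia : 'I_k * Gam) : edge m :=
  xchoose (special_exists rho z ia.1 ia.2 (b ia.1 (z ia.1, ia.2))).

Lemma special_edgeP (rho : {perm vertex}) (z : seeds) (b : bits)
    (ia : 'I_k * Gam) :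
  special rho z ia.1 ia.2 (b ia.1 (z ia.1, ia.2)) (special_edge rho z b ia).
Proof. exact: xchooseP. Qed.

(** The row gives the player; left ends are separated by cancellation, right ends by
    [double_inj]. *)
Lemma special_edge_meet (rho : {perm vertex}) (z : seeds) (b : bits)
    (ia ja : 'I_k * Gam) (x : 'I_m) :
  ia.2 \in A -> ja.2 \in A ->
  x \in val (special_edge rho z b ia) -> x \in val (special_edge rho z b ja) ->
  ia = ja.
Proof.
case: ia ja => [i a] [j c] /= aA cA.
have := special_edgeP rho z b (i, a); have := special_edgeP rho z b (j, c).
rewrite /special /= => Jj Ji; rewrite [in X in X -> _](eqP Ji) !inE.
move=> /orP[] /eqP ->; rewrite (mem_joins _ Jj) => /orP[] /eqP[] //.
  by move=> -> /addrI ->.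
by move=> -> + _; rewrite -!addrA => /addrI /(double_inj aA cA) ->.
Qed.

Lemma OPT_hard_graph_ge (rho : {perm vertex}) (z : seeds) (b : bits) :
  (k * #|A| <= OPT (hard_graph rho z b))%N.
Proof.
pose D : {set 'I_k * Gam} := finset.setX [set: 'I_k]%SET A.
have DA ia : ia \in D -> ia.2 \in A by rewrite !inE.
have gI : {in D &, injective (special_edge rho z b)}.
  move=> ia ja /DA iaA /DA jaA E.
  have xi : h (rho (Some ia.1, left_end (z ia.1, ia.2))) \in
      val (special_edge rho z b ia).
    by rewrite (mem_joins _ (special_edgeP rho z b ia)) eqxx.
  by apply: (special_edge_meet iaA jaA xi); rewrite -E.
rewrite -[k in (k * _)%N]card_ord -cardsT -cardsX -(card_in_imset gI).
apply: (@leq_bigmax_cond _ _ (fun M : {set edge m} => #|M|)).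
apply/andP; split; apply/forall_inP => e /imsetP[ia /DA iaA ->].
  exact: special_gt0 iaA (special_edgeP rho z b ia).
apply/forall_inP => e' /imsetP[ja /DA jaA ->]; apply/implyP.
apply: contraR => /pred0Pn[x /andP[xi xj]].
by rewrite (special_edge_meet iaA jaA xi xj).
Qed.

(** * Claims read off an output *)

(** Computed without the bits, as [sum_player_score_le] demands. The order of the tests matters only
    for invalid outputs, as at most one candidate is an edge. *)
Definition claim (M : {set edge m}) (rho : {perm vertex}) (z : seeds)
    (i : 'I_k) (a : Gam) : option bool :=
  if [exists e in M, special rho z i a true e] then Some true
  else if [exists e in M, special rho z i a false e] then Some false else None.

Definition claimed (M : {set edge m}) (rho : {perm vertex}) (z : seeds) :
    {set 'I_k * Gam} :=
  [set ia | claim M rho z ia.1 ia.2 != None]%SET.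

Lemma claim_correct (M : {set edge m}) (rho : {perm vertex}) (z : seeds)
    (b : bits) (i : 'I_k) (a : Gam) :
  is_matching (hard_graph rho z b) M -> claim M rho z i a != None ->
  claim M rho z i a = Some (b i (z i, a)).
Proof.
move=> /andP[/forall_inP M0 _].
rewrite /claim; case: ifP => [/existsP[e /andP[eM sp]] _|_].
  by rewrite -(special_bit sp (M0 _ eM)).
case: ifP => // /existsP[e /andP[eM sp]] _.
by rewrite -(special_bit sp (M0 _ eM)).
Qed.

(* An edge of the matching avoiding all public vertices is special, and there
   are only [3 * #|Gam|] public vertices. *)
Lemma matching_le_claimed (M : {set edge m}) (rho : {perm vertex}) (z : seeds)
    (b : bits) :
  is_matching (hard_graph rho z b) M ->
  (#|M| <= #|claimed M rho z| + #|Gam| * 3)%N.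
Proof.
move=> /andP[/forall_inP M0 /forall_inP Mdisj].
pose Mp := [set e in M | [exists v, h (rho (None, v)) \in val e]]%SET.
(* Disjointness makes [pub] injective on [Mp], where the default value never occurs. *)
pose pub (e : edge m) := odflt (0, None) [pick v | h (rho (None, v)) \in val e].
have pubP e : e \in Mp -> h (rho (None, pub e)) \in val e.
  rewrite inE /pub => /andP[_ /existsP[v ve]].
  by case: pickP => [//|/(_ v)]; rewrite ve.
have pubI : {in Mp &, injective pub}.
  move=> e e' eP e'P E; apply/eqP; have := pubP _ e'P; rewrite -E => me'.
  have := pubP _ eP; move: eP e'P; rewrite !inE => /andP[eM _] /andP[e'M _] me.
  have /forall_inP/(_ _ e'M) := Mdisj _ eM.
  apply: contraTT => ne; rewrite negb_imply ne /=.
  by apply/pred0Pn; exists (h (rho (None, pub e))); rewrite /= me me'.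
have sub : M \subset special_edge rho z b @: claimed M rho z :|: Mp.
  apply/fintype.subsetP => e eM; rewrite inE orbC [e \in Mp]inE eM /=.
  case: existsP => //= np.
  have [i [a sp]] : exists i a, special rho z i a (b i (z i, a)) e.
    apply: hard_graph_private (M0 _ eM) _ => v.
    by apply/negP => ve; apply: np; exists v.
  apply/imsetP; exists (i, a).
    rewrite inE /claim /=.
    move: sp; case: (b i (z i, a)) => sp; case: ifP => //.
      by move=> /existsP[]; exists e; rewrite eM.
    by move=> _; case: ifP => // /existsP[]; exists e; rewrite eM.
  apply/val_inj => /=; rewrite (eqP sp).
  by have /eqP -> := special_edgeP rho z b (i, a).
apply: leq_trans (subset_leq_card sub) _.
apply: leq_trans (leq_card_setU _ _) _; apply: leq_add.
  exact: leq_imset_card.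
rewrite -(card_in_imset pubI) (leq_trans (max_card _)) //.
by rewrite card_prod card_option card_bool.
Qed.

(* Keeping only [l] claims bounds the loss incurred by an unsuccessful run. *)
Definition kept (l : nat) (M : {set edge m}) (rho : {perm vertex}) (z : seeds) :
    {set 'I_k * Gam} :=
  [set ia in take l (enum (claimed M rho z))]%SET.

Definition kept_claim (l : nat) (M : {set edge m}) (rho : {perm vertex})
    (z : seeds) (i : 'I_k) (a : Gam) : option bool :=
  if (i, a) \in kept l M rho z then claim M rho z i a else None.

Lemma kept_claimed (l : nat) (M : {set edge m}) (rho : {perm vertex})
    (z : seeds) (ia : 'I_k * Gam) :
  ia \in kept l M rho z -> claim M rho z ia.1 ia.2 != None.
Proof. by rewrite inE => /mem_take; rewrite mem_enum inE. Qed.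

Lemma sum_kept_score (R : realType) (l : nat) (M : {set edge m})
    (rho : {perm vertex}) (z : seeds) (b : bits) :
  \sum_i \sum_a score R (kept_claim l M rho z i a) (b i (z i, a)) =
  \sum_(ia in kept l M rho z)
    score R (claim M rho z ia.1 ia.2) (b ia.1 (z ia.1, ia.2)).
Proof.
rewrite pair_bigA [RHS]big_mkcond /=; apply: eq_bigr => -[i a] _ /=.
by rewrite /kept_claim; case: ifP => // _; rewrite /score ln1.
Qed.

(** Valid for any [M]: at most [l] claims are kept, each scoring at least [ln (4 / 5)]. *)
Lemma sum_kept_score_ge (R : realType) (l : nat) (M : {set edge m})
    (rho : {perm vertex}) (z : seeds) (b : bits) :
  l%:R * ln (4 / 5) <=
  \sum_i \sum_a score R (kept_claim l M rho z i a) (b i (z i, a)).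
Proof.
rewrite sum_kept_score.
have ln45 : ln (4 / 5) <= 0 :> R by apply: ln_le0; lra.
apply: (@le_trans _ _ (\sum_(ia in kept l M rho z) ln (4 / 5))).
  rewrite sumr_const -[leRHS]mulr_natl ler_wnM2r // ler_nat.
  rewrite cardsE (leq_trans (card_size _)) //.
  by rewrite size_take; case: ltnP.
apply: ler_sum => ia /kept_claimed; case: claim => // c _; rewrite /score /=.
by case: ifP => // _; rewrite ler_ln ?posrE; lra.
Qed.

(** By [matching_le_claimed] there are at least [l] claims, so exactly [l] are kept, all correct. *)
Lemma sum_kept_score_success (R : realType) (l : nat) (M : {set edge m})
    (rho : {perm vertex}) (z : seeds) (b : bits) :
  is_matching (hard_graph rho z b) M -> (l + #|Gam| * 3 <= #|M|)%N ->
  \sum_i \sum_a score R (kept_claim l M rho z i a) (b i (z i, a)) =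
  l%:R * ln (6 / 5).
Proof.
move=> Mm lM; rewrite sum_kept_score.
have lC : (l <= #|claimed M rho z|)%N.
  rewrite -(leq_add2r (#|Gam| * 3)) (leq_trans lM) //.
  exact: matching_le_claimed Mm.
rewrite (eq_bigr (fun=> ln (6 / 5))) => [|ia /kept_claimed].
  rewrite sumr_const [RHS]mulr_natl; congr (_ *+ _).
  rewrite cardsE (card_uniqP _) ?take_uniq ?enum_uniq //.
  by rewrite size_takel // -cardE.
by move=> /(claim_correct Mm) ->; rewrite /score /= eqxx.
Qed.

(** * Space bound for deterministic algorithms *)

Definition instance : finType := (seeds * bits * {perm vertex} * noise)%type.

Definition instance_graph (o : instance) : multigraph m :=
  hard_graph o.1.2 o.1.1.1 o.1.1.2.

Definition inserted_state (S : nat) (D : det_alg m S) (X : noise) : state D :=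
  foldl (@step m S D) (init D) (updates true (fun e => X e)).

Definition deletion_output (S : nat) (D : det_alg m S) (s : state D)
    (Y : noise) : {set edge m} :=
  output (foldl (@step m S D) s (updates false (fun e => Y e))).

Definition instance_output (S : nat) (D : det_alg m S) (o : instance) :
    {set edge m} :=
  deletion_output
    (inserted_state D (o.2 + hard_vec o.1.2 o.1.1.1 o.1.1.2)) o.2.

Definition success (S l : nat) (D : det_alg m S) (o : instance) : bool :=
  is_matching (instance_graph o) (instance_output D o) &&
  (l + #|Gam| * 3 <= #|instance_output D o|)%N.

(** The total score is bounded twice: a player averages at most [S * ln 2 / #|Gam|], whereas at
    least 3/5 of the instances score [l * ln (6 / 5)] and the others at least [l * ln (4 / 5)]. *)
Lemma det_space_bound (R : realType) (S l : nat) (D : det_alg m S) :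
  (3 * #|instance| <= 5 * #|[set o | success l D o]%SET|)%N ->
  l%:R * #|Gam|%:R * (3 * ln (6 / 5) + 2 * ln (4 / 5)) <=
  5 * (k%:R * (S%:R * ln 2)) :> R.
Proof.
set n1 := #|[set o | _]%SET| => n1_ge.
pose F i (o : instance) : R := \sum_a score R
  (kept_claim l (instance_output D o) o.1.2 o.1.1.1 i a)
  (o.1.1.2 i (o.1.1.1 i, a)).
have upper : #|Gam|%:R * (\sum_o \sum_i F i o) <=
    k%:R * (#|instance|%:R * (S%:R * ln 2)).
  have -> (x : R) : k%:R * x = \sum_(i < k) x.
    by rewrite sumr_const card_ord mulr_natl.
  rewrite exchange_big mulr_sumr /=; apply: ler_sum => i _.
  have := @sum_player_score_le R S _ (@inserted_state S D)
    (fun s Y rho z => kept_claim l (deletion_output s Y) rho z) i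
    (state_card D).
  by rewrite !card_prod 3!pair_bigA.
have lower : #|instance|%:R * (l%:R * ln (4 / 5)) +
    n1%:R * (l%:R * (ln (6 / 5) - ln (4 / 5))) <= \sum_o \sum_i F i o.
  have -> : #|instance|%:R * (l%:R * ln (4 / 5)) +
      n1%:R * (l%:R * (ln (6 / 5) - ln (4 / 5))) =
      \sum_(o : instance) (l%:R * ln (4 / 5) +
        (success l D o)%:R * (l%:R * (ln (6 / 5) - ln (4 / 5)))) :> R.
    rewrite big_split /= sumr_const [in LHS]mulr_natl; congr (_ + _).
    rewrite -mulr_suml; congr (_ * _).
    rewrite /n1 -sum1_card natr_sum big_mkcond /=; apply: eq_bigr => o _.
    by rewrite inE; case: ifP.
  apply: ler_sum => o _; case: (boolP (success l D o)) => [/andP[Mm Ml]|_].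
    by rewrite mul1r /F sum_kept_score_success //; lra.
  by rewrite mul0r addr0; exact: sum_kept_score_ge.
have n_gt0 : 0 < #|instance|%:R :> R.
  rewrite ltr0n; apply/card_gt0P.
  by exists ([ffun=> 0], [ffun=> [ffun=> true]], 1%g, 0).
have d_ge0 : 0 <= ln (6 / 5) - ln (4 / 5) :> R.
  by rewrite subr_ge0 ler_ln ?posrE; lra.
have {}n1_ge : 3 * #|instance|%:R <= 5 * n1%:R :> R.
  by rewrite -!natrM ler_nat.
have l_ge0 : 0 <= l%:R :> R by [].
have g_ge0 : 0 <= #|Gam|%:R :> R by [].
rewrite -(ler_pM2l n_gt0).
have {lower upper} := le_trans (ler_wpM2l g_ge0 lower) upper.
set n := #|instance|%:R in n_gt0 n1_ge *; set N1 := n1%:R in n1_ge *.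
move: d_ge0; set x := ln (6 / 5); set y := ln (4 / 5); move=> d_ge0.
have : 0 <= l%:R * #|Gam|%:R * (x - y) * (5 * N1 - 3 * n).
  by rewrite !mulr_ge0 // subr_ge0.
move: (l%:R) (#|Gam|%:R) (k%:R) (S%:R * ln 2) => L G K T.
nra.
Qed.

(** * Wrap-around and reduction from randomized algorithms *)

Definition safe_noise (B : nat) : {set noise} :=
  [set Y : noise | [forall e, (Y e + B < Q.+1)%N]]%SET.

(** Union bound: a coordinate is unsafe with probability at most [B / Q.+1], seen by resampling it,
    which sums to at most 1/10. *)
Lemma card_safe_noise (B : nat) :
  (10 * (#|edge m| * B) <= Q.+1)%N -> (9 * #|noise| <= 10 * #|safe_noise B|)%N.
Proof.
move=> BQ; pose unsafe e : {set noise} := [set Y : noise | (Q < Y e + B)%N]%SET.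
have card_unsafe e : (Q.+1 * #|unsafe e| <= #|noise| * B)%N.
  rewrite -(ler_nat int) natrM -[#|unsafe e|]sum1_card natr_sum big_mkcond /=.
  rewrite -[X in X%:R * _]card_ord -(sum_fset_at e).
  apply: (@le_trans _ _ (\sum_(Y : noise) B%:R)); last first.
    by rewrite sumr_const natrM mulr_natl.
  apply: ler_sum => Y _.
  under eq_bigr do rewrite inE fset_atE.
  rewrite -big_mkcond -natr_sum ler_nat /=.
  rewrite (eq_bigl (fun x : 'I_Q.+1 => true && (Q.+1 - B <= x))%N) => [|x].
    rewrite -(big_geq_mkord _ _ xpredT (fun=> 1%N)) sum_nat_const_nat muln1.
    by lia.
  by lia.
have : (#|~: safe_noise B| <= \sum_e #|unsafe e|)%N.
  apply: (@leq_trans #|\bigcup_e unsafe e|).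
    apply: subset_leq_card; apply/fintype.subsetP => Y.
    rewrite !inE negb_forall.
    move=> /existsP[e Ye]; apply/bigcupP; exists e => //.
    by rewrite inE; move: Ye; rewrite -leqNgt.
  elim/big_rec2: _ => [|e X n _ IH]; first by rewrite cards0.
  by rewrite (leq_trans (leq_card_setU _ _)) // leq_add2l.
have : (Q.+1 * \sum_e #|unsafe e| <= #|edge m| * (#|noise| * B))%N.
  rewrite big_distrr -sum_nat_const /=; exact: leq_sum.
have := cardsC (safe_noise B).
move: #|safe_noise B| #|~: _| (\sum_e _)%N #|noise| BQ => s c t n BQ <- le1 le2.
have : (Q.+1 * (10 * c) <= Q.+1 * (s + c))%N by nia.
rewrite leq_pmul2l //; lia.
Qed.

Lemma hard_graph_le (rho : {perm vertex}) (z : seeds) (b : bits) (e : edge m) :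
  (hard_graph rho z b e <= m ^ 2)%N.
Proof.
have : (#|vertex| <= m)%N by rewrite -[leqRHS]card_ord; exact: leq_card hI.
rewrite card_prod card_option card_prod card_option card_bool card_ord => vm.
rewrite ffunE.
apply: (@leq_trans (\sum_(i < k) #|Gam| * #|Gam|)%N).
  by apply: leq_sum => i _; rewrite (leq_trans (max_card _)) ?card_prod.
rewrite sum_nat_const card_ord mulnA -mulnn.
move: vm; move: #|Gam| => g vm; apply: leq_mul; nia.
Qed.

Definition instance_stream (o : instance) : stream m :=
  updates true (fun e => o.2 e + instance_graph o e)%N ++
  updates false (fun e => o.2 e).

(** Without wrap-around the inserted multiplicities are the residues of noise plus graph. *)
Lemma run_instance (S : nat) (D : det_alg m S) (o : instance) :
  o.2 \in safe_noise (m ^ 2) -> run D (instance_stream o) = instance_output D o.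
Proof.
rewrite inE => /forallP safe.
rewrite /run /instance_stream foldl_cat.
congr (output (foldl _ (foldl _ _ _) _)).
congr flatten; apply: eq_map => e; congr (nseq _ _).
rewrite [in RHS]ffunE hard_vecE /= modnDmr modn_small //.
apply: leq_ltn_trans (safe e); rewrite leq_add2l; exact: hard_graph_le.
Qed.

Lemma measurable_run (R : realType) (S : nat) (D : rand_alg R m S)
    (s : stream m) (T : {set edge m} -> Prop) :
  measurable (fun w : seed D => T (run (alg w) s)).
Proof.
have -> : (fun w : seed D => T (run (alg w) s)) =
    (\bigcup_(M in [set M | T M]) [set w : seed D | run (alg w) s = M])%classic.
  apply/seteqP; split=> w /=; first by move=> Tw; exists (run (alg w) s).
  by move=> [M /= TM ->].
apply: fin_bigcup_measurable => [|M _]; last exact: alg_meas.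
exact: finite_finset.
Qed.

(** A seed succeeding on 2/3 of the safe instances, which are at least 9/10 of all, gives the needed
    3/5. The modulus allows [m ^ 2] edges of multiplicity up to [m ^ 2]; the stream length is at
    most [20 * m ^ 6], below [m ^ 8] as [5 <= m]. *)
Lemma rand_space_bound (R : realType) (eps : R) (S W l : nat)
    (D : rand_alg R m S) :
  (5 <= m)%N -> Q.+1 = (10 * m ^ 4)%N -> (m ^ 8 <= W)%N ->
  (l + #|Gam| * 3)%:R <= (k * #|A|)%:R / m%:R `^ eps ->
  solves_matching eps W D ->
  l%:R * #|Gam|%:R * (3 * ln (6 / 5) + 2 * ln (4 / 5)) <=
  5 * (k%:R * (S%:R * ln 2)) :> R.
Proof.
move=> m5 Qm Wm lk solves.
pose N : {set instance} := [set o | o.2 \in safe_noise (m ^ 2)]%SET.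
pose E (o : instance) : set (seed D) := fun w =>
  approx_matching eps (instance_graph o) (run (alg w) (instance_stream o)).
have cardE := card_edge_le m.
have [w] : exists w, (2 * #|N| <= 3 * #|[set o in N | w \in E o]%SET|)%N.
  apply: (@exists_seed R _ _ (seed_law D)).
    by move=> o; exact: measurable_run.
  move=> o; rewrite inE => safe; apply: solves.
  - by apply: strict_updates => e; exact: leq_addr.
  - rewrite size_cat; apply: leq_trans Wm.
    have Yle e : (o.2 e + m ^ 2 <= 10 * m ^ 4)%N.
      by move: safe; rewrite inE -Qm => /forallP/(_ e)/ltnW.
    have s1 : (size (updates true (fun e => o.2 e + instance_graph o e)) <=
        #|edge m| * (10 * m ^ 4))%N.
      apply: size_updates => e; apply: leq_trans (Yle e).
      by rewrite leq_add2l; exact: hard_graph_le.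
    have s2 : (size (updates false (fun e => o.2 e)) <=
        #|edge m| * (10 * m ^ 4))%N.
      by apply: size_updates => e; apply: leq_trans (Yle e); exact: leq_addr.
    apply: leq_trans (leq_add s1 s2) _.
    rewrite -mulnDr (leq_trans (leq_mul cardE (leqnn _))) //.
    rewrite -[8%N]/(2 + (4 + 2))%N !expnD leq_mul2l; apply/orP; right.
    have : (5 ^ 2 <= m ^ 2)%N by rewrite leq_exp2r.
    by move: (m ^ 4)%N (m ^ 2)%N => x y; nia.
  move=> e; rewrite freq_cat !freq_updates; lia.
move=> wE; apply: (@det_space_bound R S l (alg w)).
have sub : (#|[set o in N | w \in E o]%SET| <=
    #|[set o | success l (alg w) o]%SET|)%N.
  apply: subset_leq_card; apply/fintype.subsetP => o.
  rewrite !inE => /andP[safe /set_mem]; rewrite /E /success.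
  rewrite run_instance ?inE // => -[-> Ml] /=.
  rewrite -(ler_nat R) (le_trans lk) // (le_trans _ Ml) //.
  rewrite ler_wpM2r ?invr_ge0 ?powR_ge0 // ler_nat.
  exact: OPT_hard_graph_ge.
have NE :
    #|N| = (#|{: seeds * bits * {perm vertex}}| * #|safe_noise (m ^ 2)|)%N.
  rewrite -cardsT -cardsX; apply: eq_card => o; rewrite !inE.
  by [].
have : (9 * #|noise| <= 10 * #|safe_noise (m ^ 2)|)%N.
  apply: card_safe_noise; rewrite Qm leq_mul2l /=.
  by rewrite -[4%N]/(2 + 2)%N expnD leq_mul2r cardE orbT.
rewrite [#|instance|]card_prod; move: wE sub; rewrite NE.
move: #|_| #|_| #|_| #|_| #|_| => a b c d e; nia.
Qed.

End HardInstance.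

(** * A Behrend-type set *)

(* Points of a cube on a common sphere: by strict convexity the midpoint of two
   distinct ones is off the sphere. The modulus [2 d + 1] rules out carries. *)
Lemma exists_ap_free (D d : nat) :
  exists2 A : {set 'rV['I_(d.*2).+1]_D},
    {in A & &, forall a b c, a + c = b + b -> a = b} &
    (d.+1 ^ D <= #|A| * (D * d ^ 2).+1)%N.
Proof.
pose Gam := 'rV['I_(d.*2).+1]_D.
pose norm (x : Gam) : nat := (\sum_i x ord0 i ^ 2)%N.
pose box : {set Gam} := [set x : Gam | [forall i, (x ord0 i <= d)%N]]%SET.
pose A s : {set Gam} := [set x in box | norm x == s]%SET.
have boxP x i : x \in box -> (x ord0 i <= d)%N by rewrite inE => /forallP.
have norm_le x : x \in box -> (norm x < (D * d ^ 2).+1)%N.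
  move=> xb; rewrite ltnS -[D in (D * _)%N]card_ord -sum_nat_const leq_sum //.
  by move=> i _; rewrite leq_exp2r // boxP.
have card_box : (d.+1 ^ D <= #|box|)%N.
  pose f (v : {ffun 'I_D -> 'I_d.+1}) : Gam := \row_i inord (v i).
  have fE v i : f v ord0 i = v i :> nat.
    by rewrite mxE inordK // (leq_trans (ltn_ord _)) // ltnS -addnn leq_addr.
  have fI : injective f.
    by move=> v w E; apply/ffunP => i; apply/val_inj; rewrite /= -!fE E.
  have -> : (d.+1 ^ D)%N = #|{ffun 'I_D -> 'I_d.+1}|.
    by rewrite card_ffun !card_ord.
  rewrite -cardsT -(card_imset _ fI).
  apply: subset_leq_card; apply/fintype.subsetP => x /imsetP[v _ ->].
  by rewrite inE; apply/forallP => i; rewrite fE -ltnS.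
(* Pigeonhole over the possible squared norms. *)
have [s cardA] : exists s, (d.+1 ^ D <= #|A s| * (D * d ^ 2).+1)%N.
  apply: contrapT => nex.
  have lt s : (#|A s| * (D * d ^ 2).+1 < d.+1 ^ D)%N.
    by rewrite ltnNge; apply/negP => le; apply: nex; exists s.
  have boxE : #|box| = (\sum_(s < (D * d ^ 2).+1) #|A s|)%N.
    rewrite -sum1_card (partition_big
      (fun x => inord (norm x) : 'I_(D * d ^ 2).+1) xpredT) //=.
    apply: eq_bigr => s _; rewrite -sum1_card; apply: eq_bigl => x.
    rewrite [in RHS]inE; case: (boolP (x \in box)) => //= xb.
    by rewrite -val_eqE /= inordK ?norm_le.
  move: card_box; rewrite boxE leqNgt => /negP; apply.
  rewrite -(@ltn_pmul2r (D * d ^ 2).+1) //.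
  rewrite big_distrl /=.
  apply: (@leq_ltn_trans (\sum_(s < (D * d ^ 2).+1) (d.+1 ^ D).-1)%N).
    by apply: leq_sum => s _; rewrite -ltnS prednK ?expn_gt0.
  rewrite sum_nat_const card_ord mulnC ltn_pmul2r //.
  by rewrite prednK ?expn_gt0.
exists (A s) => // a b c.
have AP x : x \in A s -> x \in box /\ norm x = s.
  by rewrite inE => /andP[xb /eqP].
move=> /AP[ab na] /AP[bb nb] /AP[cb nc] E.
have Ei i : (a ord0 i + c ord0 i = b ord0 i + b ord0 i)%N.
  have := congr1 (fun x : Gam => val (x ord0 i)) E; rewrite !mxE /=.
  have /= := (boxP _ i ab, boxP _ i bb, boxP _ i cb) => -[[ia ib] ic].
  by rewrite !modn_small //; lia.
(* Parallelogram law with midpoint [b]: twice the squared distance of [a] and [b] is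
   [norm a + norm c - 2 * norm b = 0]. *)
have sum0 : \sum_i ((a ord0 i)%:Z - (b ord0 i)%:Z) ^+ 2 = 0.
  apply: (@mulIf _ 2) => //; rewrite mul0r mulr_suml.
  have -> : \sum_i ((a ord0 i)%:Z - (b ord0 i)%:Z) ^+ 2 * 2 =
      (norm a)%:Z + (norm c)%:Z - (norm b)%:Z * 2.
    rewrite /norm !(big_morph Posz PoszD (erefl 0%:Z)) mulr_suml -big_split.
    rewrite -sumrB /=; apply: eq_bigr => i _.
    have cE : (c ord0 i)%:Z = 2 * (b ord0 i)%:Z - (a ord0 i)%:Z.
      by have := Ei i; lia.
    by rewrite -!mulnn !PoszM cE; ring.
  by rewrite na nb nc; lia.
apply/rowP => i; apply/val_inj => /=.
have := psumr_eq0P (fun i _ => sqr_ge0 ((a ord0 i)%:Z - (b ord0 i)%:Z)) sum0.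
by move=> /(_ i isT)/eqP; rewrite sqrf_eq0 subr_eq0 => /eqP[].
Qed.

(** * Parameters and asymptotics *)

Lemma exists_injection (T : finType) (m : nat) :
  (#|T| <= m)%N -> exists h : T -> 'I_m, injective h.
Proof.
move=> le; exists (fun x => widen_ord le (enum_rank x)) => x y.
move=> /(congr1 val) /= E.
exact/enum_rank_inj/val_inj.
Qed.

(** [(6 / 5) ^ 3 * (4 / 5) ^ 2 = 3456 / 3125] exceeds 1. *)
Lemma score_gain_gt0 (R : realType) : 0 < 3 * ln (6 / 5) + 2 * ln (4 / 5) :> R.
Proof.
have p6 : 0 < 6 / 5 :> R by lra.
have p4 : 0 < 4 / 5 :> R by lra.
rewrite -[3]/(3%:R) -[2]/(2%:R) !mulr_natl -!lnXn // -lnM ?posrE ?exprn_gt0 //.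
by apply: ln_gt0; lra.
Qed.

Lemma powR_eventually_ge (R : realType) (s B : R) : 0 < s ->
  exists m0, forall m : nat, (m0 <= m)%N -> B <= m%:R `^ s.
Proof.
move=> s0; pose B' := Num.max 1 B.
have B'1 : 1 <= B' by rewrite le_max lexx.
have B'0 : 0 <= B' by apply: le_trans B'1.
exists (Num.truncn (B' `^ s^-1)).+1 => m mm.
apply: (@le_trans _ _ B'); first by rewrite le_max lexx orbT.
rewrite (_ : B' = (B' `^ s^-1) `^ s); last first.
  by rewrite -powRrM mulVf ?lt0r_neq0 // powRr1.
apply: ge0_ler_powR; rewrite ?nnegrE ?powR_ge0 ?ler0n ?(ltW s0) //.
apply: ltW; apply: lt_le_trans (truncnS_gt _) _.
by rewrite ler_nat.
Qed.

(** Lets [n] grow slowly with [m], so that bounds with fixed errors [a / n.+1] yield a vanishing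
    error. *)
Lemma diagonal_rate (R : realType) (a : R) (P : nat -> R -> Prop) :
  (forall n, exists m0, forall m, (m0 <= m)%N -> P m (a / n.+1%:R)) ->
  exists (delta : nat -> R) (m0 : nat),
    (delta @ \oo --> (0 : R))%classic /\ forall m, (m0 <= m)%N -> P m (delta m).
Proof.
move=> /choice[M MP].
(* The largest index up to [m] whose threshold is passed; index 0 qualifies once [M 0 <= m]. *)
pose N m := (\max_(n < m.+1 | M n <= m) n)%N.
exists (fun m => a / (N m).+1%:R), (M 0%N); split=> [|m Mm]; last first.
  have [n Mn ->] : exists2 n : 'I_m.+1, (M n <= m)%N & N m = n.
    have [|n Mn E] := @eq_bigmax_cond _ [pred n : 'I_m.+1 | M n <= m]%N
      (fun n => nat_of_ord n).
      by apply/card_gt0P; exists ord0.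
    by exists n.
  exact: MP.
have Nge n m : (maxn n (M n) <= m)%N -> (n <= N m)%N.
  rewrite geq_max => /andP[nm Mm].
  exact: (@leq_bigmax_cond _ _ (fun x : 'I_m.+1 => nat_of_ord x)
    (Ordinal (nm : n < m.+1)%N)).
apply/cvgrPdist_le => /= e e0.
pose n := Num.truncn (`|a| / e).
near=> m; rewrite sub0r normrN normrM normfV (ger0_norm (ler0n _ _)).
rewrite ler_pdivrMr //.
rewrite -ler_pdivrMl // mulrC; apply: ltW; apply: lt_le_trans (truncnS_gt _) _.
rewrite ler_nat ltnS; apply: Nge; near: m.
exact: nbhs_infty_ge.
Unshelve. all: by end_near.
Qed.

(** Up to constants depending on [n]: [#|Gam|] is [t ^ n.+1], [#|AP|] is at least [#|Gam| / t ^ 2],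
    [k] is [t ^ 2 * m ^ eps], and [t] is [m ^ ((1 - eps) / n.+3)]. The vertices fit in [m], and the
    space [#|Gam| ^ 2 / k] is [t ^ n.*2 / m ^ eps]. *)
Lemma poly_space_bound (R : realType) (n : nat) (eps : R) :
  0 < eps -> eps < 1 / 2 ->
  exists2 c : R, 0 < c & exists m0, forall m W S : nat,
    (m0 <= m)%N -> m%:R `^ 8 <= W%:R :> R ->
    forall A : rand_alg R m S, solves_matching eps W A ->
    c * m%:R `^ ((1 - eps) / n.+3%:R * (n.*2)%:R - eps) <= S%:R.
Proof.
move=> eps0 eps2; pose D := n.+1.
(* The constant in the vertex count, which becomes [K * t ^ D.+2 * p <= m]. *)
pose K : R := 48 * (4 ^+ D * D%:R).
pose c1 : R := 3 * ln (6 / 5) + 2 * ln (4 / 5).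
have c1_gt0 : 0 < c1 by exact: score_gain_gt0.
have ln2_gt0 : 0 < ln 2 :> R by apply: ln_gt0; lra.
have D_ge1 : 1 <= D%:R :> R by rewrite ler1n.
have K_ge1 : 1 <= K.
  have : 1 <= 4 ^+ D * D%:R :> R.
    by rewrite mulr_ege1 // exprn_ege1 //; lra.
  rewrite /K; lra.
have K_gt0 : 0 < K by apply: lt_le_trans K_ge1.
(* [(2 * K) ^ n.*2] pays for [u <= 2 * K * t], the rest for [x] in the space bound. *)
pose c : R := c1 / (40 * 2 ^+ D * D%:R * ln 2 * (2 * K) ^+ n.*2).
have den_gt0 : 0 < 40 * 2 ^+ D * D%:R * ln 2 * (2 * K) ^+ n.*2.
  have : 0 < 2 ^+ D :> R by rewrite exprn_gt0.
  have : 0 < D%:R :> R by rewrite ltr0n.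
  have : 0 < (2 * K) ^+ n.*2 by rewrite exprn_gt0 // mulr_gt0.
  by move=> X1 X2 X3; rewrite !mulr_gt0.
have c_gt0 : 0 < c by rewrite divr_gt0.
have s_gt0 : 0 < (1 - eps) / n.+3%:R by rewrite divr_gt0 //; lra.
have [m1 m1P] := powR_eventually_ge K s_gt0.
exists c => //; exists (maxn 5 m1) => m W S.
rewrite geq_max => /andP[m5 /m1P]; set u := m%:R `^ _ => Ku Wm A solves.
have m_neq0 : m%:R != 0 :> R by rewrite pnatr_eq0 -lt0n (leq_trans _ m5).
have u_gt0 : 0 < u by apply: lt_le_trans Ku.
pose p : R := m%:R `^ eps.
have p_ge1 : 1 <= p.
  have m_ge1 : 1 <= m%:R :> R by rewrite ler1n (leq_trans _ m5).
  by have := ler_powR m_ge1 (ltW eps0); rewrite powRr0.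
have p_gt0 : 0 < p by apply: lt_le_trans p_ge1.
have uX : u ^+ n.+3 * p = m%:R.
  rewrite /u /p -powR_mulrn ?powR_ge0 // -powRrM.
  rewrite mulfVK ?pnatr_eq0 // -powRD ?m_neq0 ?implybT //.
  by rewrite subrK powRr1 ?ler0n.
have y_ge1 : 1 <= u / K by rewrite ler_pdivlMr // mul1r.
have := truncn_itv (le_trans ler01 y_ge1); rewrite -truncn_gt0 in y_ge1.
(* [t] is the floor of [u / K]; being at least 1, it loses at most a factor 2. *)
case: (Num.truncn _) y_ge1 => [//|d] _ /andP[]; set t := d.+1 => ty yt.
have t_ge1 : 1 <= t%:R :> R by rewrite ler1n.
have t_gt0 : 0 < t%:R :> R by apply: lt_le_trans t_ge1.
have y2t : u / K <= 2 * t%:R by move: yt; rewrite -natr1; lra.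
have [AP apA cardA] := exists_ap_free D d.
set Gam := 'rV['I_(d.*2).+1]_D in AP apA cardA.
have cardG : #|Gam| = ((d.*2).+1 ^ D)%N by rewrite card_mx card_ord mul1n.
have G_ge : t%:R ^+ D <= #|Gam|%:R :> R.
  by rewrite -natrX ler_nat cardG leq_exp2r // ltnS -addnn leq_addr.
have G_le : #|Gam|%:R <= 2 ^+ D * t%:R ^+ D :> R.
  rewrite -exprMn -natrM -natrX ler_nat cardG leq_exp2r //.
  by rewrite mul2n doubleS ltnW.
have A_ge : t%:R ^+ D <= #|AP|%:R * (D%:R * t%:R ^+ 2) :> R.
  rewrite -!natrX -!natrM ler_nat (leq_trans cardA) // leq_mul2l.
  apply/orP; right.
  apply: (@leq_trans (D * (d ^ 2).+1)).
    by rewrite mulnS -add1n leq_add2r.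
  by rewrite leq_mul2l ltn_exp2r // ltnSn orbT.
(* Chosen so that [x * #|AP| >= 4 * #|Gam| * p]; [k] is the first integer above [x]. *)
pose x : R := 4 * 2 ^+ D * D%:R * t%:R ^+ 2 * p.
have pow2 : 1 <= 2 ^+ D :> R by apply: exprn_ege1; lra.
have x_ge1 : 1 <= x.
  by rewrite /x !mulr_ege1 // ?exprn_ege1 //; lra.
have := truncn_itv (le_trans ler01 x_ge1); set k := (Num.truncn x).+1.
rewrite -/k => /andP[kx xk].
have k_le : k%:R <= 2 * x by rewrite /k -natr1; lra.
have vm : (#|vertex k Gam| <= m)%N.
  rewrite card_prod card_option card_prod card_option card_bool card_ord.
  rewrite -(ler_nat R) !natrM -uX.
  have k1 : k.+1%:R <= 4 * x by rewrite -natr1; lra.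
  apply: (@le_trans _ _ (4 * x * (2 ^+ D * t%:R ^+ D * 3))).
    by rewrite ler_pM // ler_pM.
  have tyX : t%:R ^+ D.+2 <= (u / K) ^+ D.+2.
    by rewrite lerXn2r ?nnegrE // ltW // divr_gt0.
  have KX : K * (u / K) ^+ D.+2 <= u ^+ D.+2.
    rewrite expr_div_n mulrCA ler_piMr ?exprn_ge0 ?(ltW u_gt0) //.
    by rewrite ler_pdivrMr ?exprn_gt0 // mul1r -[leLHS]expr1 ler_weXn2l.
  have {KX}tK : K * t%:R ^+ D.+2 <= u ^+ D.+2.
    by apply: le_trans KX; rewrite ler_pM2l.
  rewrite -(ler_pM2r p_gt0) in tK; apply: le_trans tK; rewrite le_eqVlt.
  apply/orP; left; apply/eqP; rewrite /x /K [in 4 ^+ D](_ : 4 = 2 * 2 :> R).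
    by rewrite exprMn !exprS; ring.
  by lra.
have [h hI] := exists_injection vm.
have Q_eq : ((10 * m ^ 4).-1.+1 = 10 * m ^ 4)%N.
  by rewrite prednK // muln_gt0 expn_gt0 (leq_trans _ m5).
(* Of [4 * #|Gam|] guaranteed edges, [3 * #|Gam|] may touch public vertices, leaving
   [l = #|Gam|]. *)
have lk : (#|Gam| + #|Gam| * 3)%:R <= (k * #|AP|)%:R / m%:R `^ eps :> R.
  rewrite -/p ler_pdivlMr // -[X in (X + _)%N]muln1 -mulnDr !natrM.
  have Dt_gt0 : 0 < D%:R * t%:R ^+ 2 :> R.
    by rewrite mulr_gt0 ?exprn_gt0 // (lt_le_trans ltr01).
  rewrite -(ler_pM2r Dt_gt0).
  apply: (@le_trans _ _ (x * t%:R ^+ D)).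
    apply: (@le_trans _ _ (2 ^+ D * t%:R ^+ D * 4 * p * (D%:R * t%:R ^+ 2))).
      by rewrite !ler_wpM2r // ltW.
    by rewrite /x le_eqVlt; apply/orP; left; apply/eqP; ring.
  rewrite -[leRHS]mulrA; apply: ler_pM => //; last exact: ltW.
  exact: le_trans ler01 x_ge1.
have Wm' : (m ^ 8 <= W)%N by rewrite -(ler_nat R) natrX -powR_mulrn.
have {Wm'} := rand_space_bound hI apA m5 Q_eq Wm' lk solves.
rewrite -/c1 => bound.
have k_gt0 : 0 < k%:R :> R by rewrite ltr0n.
have S_ge0 : 0 <= S%:R :> R by [].
have t2 : t%:R ^+ D * t%:R ^+ D * c1 <= 10 * x * ln 2 * S%:R.
  apply: (@le_trans _ _ (#|Gam|%:R * #|Gam|%:R * c1)).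
    by rewrite ler_pM2r // ler_pM ?exprn_ge0.
  apply: le_trans bound _.
  have := ler_wpM2r (mulr_ge0 (ltW ln2_gt0) S_ge0) k_le; lra.
have t2' : t%:R ^+ n.*2 * c1 <= 40 * 2 ^+ D * D%:R * ln 2 * p * S%:R.
  rewrite -(ler_pM2l (exprn_gt0 2 t_gt0)).
  move: t2; rewrite /x (_ : t%:R ^+ D * t%:R ^+ D = t%:R ^+ 2 * t%:R ^+ n.*2).
    rewrite -[leLHS]mulrA => H; apply: le_trans H _.
    by rewrite le_eqVlt; apply/orP; left; apply/eqP; ring.
  by rewrite -!exprD /D addSn addnS addnn.
have uE : m%:R `^ ((1 - eps) / n.+3%:R * (n.*2)%:R - eps) = u ^+ n.*2 / p.
  rewrite powRD ?m_neq0 ?implybT // powRN -/p; congr (_ * _).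
  by rewrite powRrM powR_mulrn ?powR_ge0.
have ut : u ^+ n.*2 <= (2 * K) ^+ n.*2 * t%:R ^+ n.*2.
  rewrite -exprMn lerXn2r ?nnegrE ?mulr_ge0 ?(ltW u_gt0) ?(ltW K_gt0) //.
  by move: y2t; rewrite ler_pdivrMr //; lra.
rewrite uE /c mulrA ler_pdivrMr // mulrAC ler_pdivrMr //.
have := ler_wpM2l (ltW c1_gt0) ut.
have := ler_wpM2l (exprn_ge0 n.*2 (mulr_ge0 (ler0n R 2) (ltW K_gt0))) t2'.
move: ((2 * K) ^+ n.*2) (t%:R ^+ n.*2) (u ^+ n.*2) (2 ^+ D) => a1 a2 a3 a4.
move=> H1 H2; apply: le_trans H2 _.
rewrite mulrCA [c1 * _]mulrC; apply: le_trans H1 _.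
by rewrite le_eqVlt; apply/orP; left; apply/eqP; ring.
Qed.

(** * The exponent as the dimension grows *)

Local Open Scope classical_set_scope.

Theorem theorem7p2p3 (R : realType) :
  exists2 C0 : R, 0 < C0 &
  forall eps : R, 0 < eps -> eps < 1 / 2 ->
  exists (c : R) (delta : nat -> R) (m0 : nat),
    [/\ 0 < c,
        delta @ \oo --> (0 : R) &
        forall m W S : nat, (m0 <= m)%N -> m%:R `^ C0 <= W%:R :> R ->
        forall A : rand_alg R m S, solves_matching eps W A ->
        c * m%:R `^ (2 - 3 * eps - delta m) <= S%:R].
Proof.
(* 8 is the exponent in the stream length bound [m ^ 8]. *)
exists 8 => // eps eps0 eps2.
pose P m (x : R) := forall W S : nat, m%:R `^ 8 <= W%:R :> R ->
  forall A : rand_alg R m S, solves_matching eps W A ->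
  m%:R `^ (2 - 3 * eps - x) <= S%:R.
(* The error [7 / n.+1] covers [6 / n.+3], from doubling [n / n.+3 = 1 - 3 / n.+3], and [1 / n.+3],
   from absorbing [c] into [m ^ (1 / n.+3)]. *)
have [n|delta [m0 [delta0 deltaP]]] := @diagonal_rate R 7 P.
  have [c c0 [m1 m1P]] := poly_space_bound n eps0 eps2.
  have n3 : 0 < n.+3%:R :> R by rewrite ltr0n.
  have s0 : 0 < n.+3%:R^-1 :> R by rewrite invr_gt0.
  have [m2 m2P] := powR_eventually_ge c^-1 s0.
  exists (maxn 1 (maxn m1 m2)) => m; rewrite !geq_max => /and3P[m_gt0 mm1 mm2].
  move=> W S Wm A solves.
  have m_ge1 : 1 <= m%:R :> R by rewrite ler1n.
  have m_neq0 : m%:R != 0 :> R by rewrite pnatr_eq0 -lt0n.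
  apply: le_trans (m1P m W S mm1 Wm A solves).
  have := m2P m mm2; rewrite -[c^-1]mul1r ler_pdivrMr // => cm.
  apply: (@le_trans _ _ (m%:R `^ (2 - 3 * eps - 7 / n.+1%:R) *
      (m%:R `^ n.+3%:R^-1 * c))).
    by rewrite ler_peMr ?powR_ge0.
  rewrite mulrA mulrC ler_pM2l // -powRD ?m_neq0 ?implybT // ler_powR //.
  have vw : n.+3%:R^-1 <= n.+1%:R^-1 :> R.
    by rewrite lef_pV2 ?posrE ?ltr0n // ler_nat ltnS leqW.
  have nv : n%:R * n.+3%:R^-1 = 1 - 3 * n.+3%:R^-1 :> R.
    have := mulfV (lt0r_neq0 n3); move: (n.+3%:R^-1) => v.
    by rewrite -addn3 natrD mulrDl; lra.
  rewrite (_ : (1 - eps) / n.+3%:R * (n.*2)%:R =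
    (1 - eps) * (2 * (n%:R * n.+3%:R^-1))).
    rewrite nv; have := mulr_ge0 (ltW eps0) (ltW s0); move: vw.
    by move: (n.+3%:R^-1) (n.+1%:R^-1) => v w; lra.
  by rewrite -mul2n natrM; ring.
exists 1, delta, m0; split=> // m W S mm Wm A solves.
by rewrite mul1r; exact: (deltaP m mm W S Wm A solves).
Qed.
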